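(* Let $a(n,m)$ denote the number of Arndt compositions of $n$ with exactly $m$ parts. For all integers $n,m\ge 0$, $$\left(m-n-2+\lfloor m/2\rfloor\right)a(n+2,m) + \left(m-\lfloor m/2\rfloor\right)a(n+1,m) + n\,a(n,m)=0.$$
   Context: A composition of $n\ge 0$ is a finite sequence $(\sigma_1,\dots,\sigma_\ell)$ of positive integers summing to $n$ (the empty composition is the composition of $0$ with $0$ parts). An Arndt composition is one with $\sigma_{2i-1}>\sigma_{2i}$ for every positive integer $i$ with $2i\le\ell$. *)

(* Defs.v *)
From mathcomp Require Import all_boot all_order all_algebra.

Set Implicit Arguments.
Unset Strict Implicit.
Unset Printing Implicit Defensive.

Definition is_composition (n : nat) (s : seq nat) : bool :=
  all (fun x => 0 < x) s && (sumn s == n).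

(* Parts are 0-indexed: for 0 <= i < floor(l/2), the entries at positions 2i
   and 2i+1 are sigma_{2(i+1)-1} and sigma_{2(i+1)}. *)
Definition is_arndt (s : seq nat) : bool :=
  [forall i : 'I_(size s)./2, nth 0 s i.*2.+1 < nth 0 s i.*2].

(* The parts of a composition of n are at most n, so the compositions of n with
   m parts are counted among the m-tuples over 'I_n.+1; see arndt_countP. *)
Definition arndt_count (n m : nat) : nat :=
  #|[set t : m.-tuple 'I_n.+1 |
      is_composition n (map val t) && is_arndt (map val t)]|.

Lemma arndt_countP (n m : nat) (L : seq (seq nat)) :
  uniq L ->
  (forall s, (s \in L) = [&& size s == m, is_composition n s & is_arndt s]) ->
  arndt_count n m = size L.
Proof.
move=> uL memL; rewrite /arndt_count cardE.
set E := enum _; pose f (t : m.-tuple 'I_n.+1) : seq nat := map val t.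
have f_inj : injective f by move=> t u /(inj_map val_inj) /val_inj.
rewrite -(size_map f E); apply/perm_size/uniq_perm => //.
  by rewrite map_inj_uniq ?enum_uniq.
move=> s; rewrite memL; apply/mapP/and3P.
  by case=> t; rewrite mem_enum inE => /andP[c a] ->; rewrite size_map size_tuple.
case=> /eqP sz c a.
have le_n x : x \in s -> x < n.+1.
  by case/andP: c => _ /eqP <- xs; rewrite ltnS (perm_sumn (perm_to_rem xs)) leq_addr.
have fE : map val [seq (inord x : 'I_n.+1) | x <- s] = s.
  by rewrite -map_comp map_id_in // => x /le_n lt; rewrite /= inordK.
have szt : size [seq (inord x : 'I_n.+1) | x <- s] == m by rewrite size_map sz.
by exists (Tuple szt); rewrite ?mem_enum ?inE /f /= fE ?c.
Qed.

(* Main.v *)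
Require Import Defs.
From mathcomp Require Import all_boot all_order all_algebra.
From mathcomp Require Import zify.
Local Open Scope ring_scope.

(** With [k = m./2], the generating function of [a(n, m)] in [n] is
    [F = x^(m+k) / ((1-x)^m (1+x)^k)]; its logarithmic derivative gives
    [(1-x^2) x F' = ((m+k) + (m-k) x) F], which is the claim coefficientwise.
    Prepending a pair [x > y] multiplies [F] by [x^3 / ((1-x)(1-x^2))]: such a
    pair is [(2, 1)] after raising both entries some number of times, and then
    the first entry some number of times.  This is a linear recurrence linking
    [a(_, m+2)] to [a(_, m)], along which the differential equation is
    transported by induction on [m] in steps of two. *)

Local Open Scope nat_scope.

Definition incr_first (s : seq nat) : seq nat :=
  if s is x :: t then x.+1 :: t else s.

Definition incr_both (s : seq nat) : seq nat :=
  if s is x :: y :: t then x.+1 :: y.+1 :: t else s.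

Lemma incr_first_inj : injective incr_first.
Proof. by case=> [|x s] [|y t] //= [-> ->]. Qed.

Lemma incr_both_inj : injective incr_both.
Proof. by case=> [|x [|y s]] [|x' [|y' s']] //= [] // -> -> ->. Qed.

(* [A n] stands for a list of sequences of sum [n]; [close_pairs A n] lists the
   sequences [y.+1 :: y :: t] of sum [n] with [0 < y] and [t] in [A]. *)
Fixpoint close_pairs (A : nat -> seq (seq nat)) (n : nat) : seq (seq nat) :=
  if n is (n'.+1 as p).+2 then
    map incr_both (close_pairs A p) ++ map (fun t => [:: 2, 1 & t]) (A n')
  else [::].

Fixpoint strict_pairs (A : nat -> seq (seq nat)) (n : nat) : seq (seq nat) :=
  if n is p.+1 then map incr_first (strict_pairs A p) ++ close_pairs A n
  else [::].

Lemma mem_close_pairs A n s :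
  (s \in close_pairs A n) =
  if s is x :: y :: t then
    [&& 0 < y, x == y.+1, x + y <= n & t \in A (n - (x + y))]
  else false.
Proof.
have [k] := ubnP n; elim: k n s => // k IH n s le_n_k.
case: n le_n_k => [|[|[|n]]] le_n_k;
  try by case: s => [|x [|y t]] //; rewrite in_nil; symmetry;
    apply/negP => /and4P[? /eqP ? ? _]; lia.
rewrite [close_pairs _ _]/= -/(close_pairs A n.+1) mem_cat.
have cons21_inj : injective (fun t : seq nat => [:: 2, 1 & t]) by move=> ? ? [].
have memIH u : u \in close_pairs A n.+1 ->
    exists y t, u = [:: y.+2, y.+1 & t].
  rewrite IH; last by lia.
  by case: u => [|x [|[|y] t]] // /and4P[_ /eqP-> _ _]; exists y, t.
case: s => [|x [|y t]].
- by apply/negbTE/norP; split; apply/mapP => -[u] // /memIH[y [t ->]].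
- by apply/negbTE/norP; split; apply/mapP => -[u] // /memIH[y [t ->]].
(* The second entry decides which half of the concatenation can contain the sequence: 1 forces a
   fresh pair (2, 1), and 2 or more forces an image under [incr_both]. *)
case: y => [|[|y]].
- by apply/negbTE/norP; split; apply/mapP => -[u] // /memIH[y [t' ->]].
- have -> : ([:: x, 1 & t] \in map incr_both (close_pairs A n.+1)) = false.
    by apply/mapP => -[u] /memIH[y [t' ->]].
  have [->|nx] := eqVneq x 2; last first.
    by rewrite /=; apply/mapP => -[u _ [ex]]; rewrite ex in nx.
  rewrite (mem_map cons21_inj) /=.
  by have -> : n.+3 - (2 + 1) = n by lia.
have -> : ([:: x, y.+2 & t] \in map (fun t => [:: 2, 1 & t]) (A n)) = false.
  by apply/mapP => -[u _ []].
case: x => [|x].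
  by rewrite orbF; apply/mapP => -[u] /memIH[y' [t' ->]].
rewrite orbF -[_ :: _]/(incr_both [:: x, y.+1 & t]) (mem_map incr_both_inj).
rewrite IH; last by lia.
have -> : n.+3 - (x.+1 + y.+2) = n.+1 - (x + y.+1) by lia.
by rewrite /= eqSS; congr [&& _, _ & _]; lia.
Qed.

Lemma mem_strict_pairs A n s :
  (s \in strict_pairs A n) =
  if s is x :: y :: t then
    [&& 0 < y, y < x, x + y <= n & t \in A (n - (x + y))]
  else false.
Proof.
elim: n s => [|n IH] s.
  case: s => [|x [|y t]] //; rewrite in_nil; symmetry.
  by apply/negP => /and4P[? ? ? _]; lia.
rewrite [strict_pairs _ _]/= -/(close_pairs A n.+1) mem_cat mem_close_pairs.
have memIH u : u \in strict_pairs A n ->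
    exists x y t, [/\ u = [:: x, y & t], 0 < y & y < x].
  by rewrite IH; case: u => [|x [|y t]] // /and4P[? ? _ _]; exists x, y, t.
case: s => [|x [|y t]].
- by rewrite orbF; apply/mapP => -[u] /memIH[? [? [? [-> _ _]]]].
- by rewrite orbF; apply/mapP => -[u] /memIH[? [? [? [-> _ _]]]].
case: x => [|x].
  by rewrite !andbF orbF; apply/mapP => -[u] /memIH[? [? [? [-> _ _]]]].
rewrite -[_ :: _]/(incr_first [:: x, y & t]) (mem_map incr_first_inj) IH.
have -> : n.+1 - (x.+1 + y) = n - (x + y) by lia.
(* For a positive first entry [x.+1], the condition [y < x.+1] splits into [y < x] (raised first
   entry) and [x = y] (close pair). *)
case: (t \in _); last by rewrite !andbF.
by rewrite !andbT; lia.
Qed.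

Lemma close_pairs_uniq A n : (forall p, uniq (A p)) -> uniq (close_pairs A n).
Proof.
move=> uA; have [k] := ubnP n; elim: k n => // k IH [|[|[|n]]] // le_n_k.
rewrite [close_pairs _ _]/= -/(close_pairs A n.+1) cat_uniq.
rewrite (map_inj_uniq incr_both_inj) IH; last by lia.
rewrite map_inj_uniq ?uA ?andbT ?andTb; last by move=> ? ? [].
(* An image under [incr_both] has second entry at least 2, since [close_pairs] only has positive
   second entries. *)
apply/hasPn => _ /mapP[t _ ->]; apply/mapP => -[u].
by rewrite mem_close_pairs; case: u => [|x [|[|y] t']].
Qed.

Lemma strict_pairs_uniq A n : (forall p, uniq (A p)) -> uniq (strict_pairs A n).
Proof.
move=> uA; elim: n => // n IH.
rewrite [strict_pairs _ _]/= -/(close_pairs A n.+1) cat_uniq.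
rewrite (map_inj_uniq incr_first_inj) IH close_pairs_uniq // andbT andTb.
(* The first two entries differ by exactly 1 in [close_pairs], but by at least 2 after
   [incr_first]. *)
apply/hasPn => s; rewrite mem_close_pairs => Ds; apply/mapP => -[u].
rewrite mem_strict_pairs; case: u => [|x [|y t]] // /and4P[_ lt_yx _ _] Es.
by move: Ds; rewrite Es /= => /and4P[_ /eqP ? _ _]; lia.
Qed.

Lemma size_close_pairs A n :
  size (close_pairs A n.+3) = size (close_pairs A n.+1) + size (A n).
Proof. by rewrite [close_pairs A n.+3]/= size_cat !size_map. Qed.

Lemma size_strict_pairsS A n :
  size (strict_pairs A n.+1)
  = size (strict_pairs A n) + size (close_pairs A n.+1).
Proof. by rewrite [strict_pairs A n.+1]/= size_cat size_map. Qed.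

(* The coefficients of [(1-x)(1-x^2) G = x^3 F]. *)
Lemma size_strict_pairs A n :
  size (strict_pairs A n.+3) + size (strict_pairs A n)
  = size (strict_pairs A n.+2) + size (strict_pairs A n.+1) + size (A n).
Proof.
have := size_close_pairs A n.
have := size_strict_pairsS A n; have := size_strict_pairsS A n.+2; lia.
Qed.

Fixpoint arndts (m : nat) : nat -> seq (seq nat) :=
  match m with
  | 0 => fun n => if n is 0 then [:: [::]] else [::]
  | 1 => fun n => if n is 0 then [::] else [:: [:: n]]
  | p.+2 => strict_pairs (arndts p)
  end.

Lemma nat_ind2 (P : nat -> Prop) :
  P 0 -> P 1 -> (forall m, P m -> P m.+2) -> forall m, P m.
Proof.
move=> P0 P1 PS m; suff [] : P m /\ P m.+1 by [].
by elim: m => // m [Pm PSm]; split; last exact: PS.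
Qed.

Lemma arndts_uniq m n : uniq (arndts m n).
Proof.
by elim/nat_ind2: m n => [[]|[]|m IH n] //; apply: strict_pairs_uniq.
Qed.

(** Removing a whole pair keeps the parity of positions, so the later pairs are only reindexed by
    one. *)
Lemma is_arndt_cons2 x y s : is_arndt [:: x, y & s] = (y < x) && is_arndt s.
Proof.
apply/forallP/andP => [H|[lt_yx /forallP H] [[|i] lt_i]] //=; last first.
  exact: (H (Ordinal (lt_i : i < (size s)./2))).
split; first exact: (H ord0).
apply/forallP => i; have lt_i : i.+1 < (size [:: x, y & s])./2 by case: i.
exact: (H (Ordinal lt_i)).
Qed.

Lemma mem_arndts m n s :
  (s \in arndts m n) = [&& size s == m, is_composition n s & is_arndt s].
Proof.
have short t : size t < 2 -> is_arndt t.
  by move=> lt_t; apply/forallP => -[i lt_i]; exfalso; lia.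
elim/nat_ind2: m n s => [n s|n s|m IH n s].
- case: s => [|x s]; last by case: n.
  by rewrite short // /is_composition /=; case: n.
- case: s => [|x [|y s]]; first by case: n.
    rewrite short // /is_composition /= addn0 !andbT.
    by case: n => [|n]; [case: x | rewrite inE eqseq_cons andbT; lia].
  by case: n => [|n] //=; rewrite inE eqseq_cons andbF.
rewrite -[arndts m.+2]/(strict_pairs (arndts m)) mem_strict_pairs.
case: s => [|x [|y t]] //; rewrite is_arndt_cons2 IH /is_composition /= !eqSS.
case: (size t == m); last by rewrite !andbF.
case: (all _ t); last by rewrite !andbF.
case: (is_arndt t); last by rewrite !andbF.
by rewrite !andbT /=; lia.
Qed.

Lemma arndt_countE n m : arndt_count n m = size (arndts m n).
Proof. exact: arndt_countP (arndts_uniq m n) (mem_arndts m n). Qed.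

Local Open Scope ring_scope.

(* The recurrence [(1-x^2) x F' = ((m+k) + (m-k) x) F] for the coefficients [a]
   of [F]; the first two conjuncts are its instances [n = -2] and [n = -1]. *)
Definition arndt_rec (m k : int) (a : nat -> int) : Prop :=
  [/\ (m + k) * a 0%N = 0,
      (m + k - 1) * a 1%N + (m - k) * a 0%N = 0
    & forall n : nat,
        (m - n%:Z - 2%:Z + k) * a n.+2 + (m - k) * a n.+1 + n%:Z * a n = 0].

(** Let $E_a(n)$ and $E_b(n)$ be the left-hand sides of the third conjunct for [a] and [b], each
    with its own parameters. Expanding $b$ by its recurrence gives $E_b(n+3) = E_b(n+2) + E_b(n+1) -
    E_b(n) + E_a(n)$, so $E_b$ vanishes by strong induction. *)
Lemma arndt_rec_pair (m k : int) (a b : nat -> int) :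
    b 0%N = 0 -> b 1%N = 0 -> b 2%N = 0 ->
    (forall n, b n.+3 = b n.+2 + b n.+1 - b n + a n) ->
  arndt_rec m k a -> arndt_rec (m + 2) (k + 1) b.
Proof.
move=> b0 b1 b2 bS [a0 a1 aS]; split=> [||n]; try by rewrite ?b0 ?b1; lia.
have [q] := ubnP n; elim: q n => // q IH [|[|[|n]]] lt_n_q.
(* The cases $n = 1$ and $n = 2$ reduce to the two boundary conjuncts for [a], through $b_3 = a_0$
   and $b_4 = a_0 + a_1$. *)
- by rewrite b1 b2; lia.
- by rewrite bS b0 b1 b2; lia.
- by rewrite (bS 1%N) (bS 0%N) b0 b1 b2; lia.
have [lt0 lt1 lt2] : [/\ (n < q)%N, (n.+1 < q)%N & (n.+2 < q)%N] by split; lia.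
move: (IH _ lt2) (IH _ lt1) (IH _ lt0) (aS n).
rewrite (bS n.+2) (bS n.+1) (bS n); lia.
Qed.

Lemma arndts_rec (m : nat) : arndt_rec m m./2 (fun n => (size (arndts m n))%:Z).
Proof.
(* The base series are $1$ for no parts and $x/(1-x)$ for one part. *)
elim/nat_ind2: m => [|| m IH]; try by split=> // -[|n] /=; lia.
have -> : m.+2%:Z = m%:Z + 2 by lia.
have -> : m.+2./2%:Z = m./2%:Z + 1 by lia.
apply: arndt_rec_pair IH => // n.
by have := size_strict_pairs (arndts m) n => /=; lia.
Qed.

Theorem theorem2p4 (n m : nat) :
  (m%:Z - n%:Z - 2%:Z + (m./2)%:Z) * (arndt_count n.+2 m)%:Z
    + (m%:Z - (m./2)%:Z) * (arndt_count n.+1 m)%:Z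
    + n%:Z * (arndt_count n m)%:Z = 0.
Proof. by rewrite !arndt_countE; have [_ _] := arndts_rec m; apply. Qed.
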